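(* Let $K$ be a field and let $\{f_n(q)\}_{n=1}^\infty$ be a sequence of polynomials in $K[q]$ satisfying \[ f_{m+n+k}(q) = f_m(q) + q^m f_n(q) + q^m f_k(q) + q^m(q-1) f_n(q) f_k(q) \] for all positive integers $m,n,k$. Then the sequence is one of the trivial solutions: either $f_n(q)=[n]_q$ for all $n\ge 1$, or $f_n(q)=0$ for all $n\ge 1$.
   Context: For a positive integer $n$, the $q$-integer is the polynomial $[n]_q = 1+q+q^2+\dots+q^{n-1}$ in the indeterminate $q$. Equalities are equalities of polynomials in $K[q]$. *)

(* Defs.v *)
From HB Require Import structures.
From mathcomp Require Import all_boot all_order all_algebra.

Set Implicit Arguments.
Unset Strict Implicit.
Unset Printing Implicit Defensive.

Import GRing.Theory.
Local Open Scope ring_scope.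

(* [n]_q = 1 + q + ... + q^(n-1), the indeterminate q being 'X. *)
Definition qint (K : fieldType) (n : nat) : {poly K} := \sum_(i < n) 'X^i.

(* Main.v *)
(** With [g n = 1 + (q - 1) f n] the hypothesis reads
    [g (m + n + k) = g m + q^m (g n g k - 1)], so [g n * g k] depends only on
    [n + k].  From [g 1 g 3 = (g 2)^2] and [g 1 g 4 = g 2 g 3] one gets
    [q (g 1^2 - 1) (q g 1 - g 2) = 0], and each factor determines [g 1] and
    [g 2] because [g n] takes the value 1 at [q = 1].  The recursion
    [g (m + 2) = g m + q^m (g 1^2 - 1)] then determines all of [g]. *)
Require Import Defs.
From HB Require Import structures.
From mathcomp Require Import all_boot all_order all_algebra.
From mathcomp Require Import ring.

Set Implicit Arguments.
Unset Strict Implicit.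
Unset Printing Implicit Defensive.

Import GRing.Theory.
Local Open Scope ring_scope.

Section MultiplicativeForm.

Variables (K : fieldType) (g : nat -> {poly K}).
Hypothesis g_at1 : forall n, (g n).[1] = 1.
Hypothesis g_rec : forall m n k, (0 < m)%N -> (0 < n)%N -> (0 < k)%N ->
  g (m + n + k)%N = g m + 'X^m * (g n * g k - 1).

Lemma sqr_eq1_at1 (p : {poly K}) : p.[1] = 1 -> p ^+ 2 = 1 -> p = 1.
Proof.
move=> p1 /eqP; rewrite sqrf_eq1 => /orP[/eqP // | /eqP pN1].
(* In the case [p = -1], evaluation at 1 gives [1 = -1] in [K]. *)
have e : 1 = -1 :> K by rewrite -{1}p1 pN1 hornerN hornerC.
by rewrite pN1 -polyC1 -polyCN -e.
Qed.

(** Expanding [g (1 + n + k)] by [g_rec] with [m = 1] leaves [g n * g k] as the only term not fixed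
    by the sum [n + k]; the nonzero factor ['X] cancels. *)
Lemma mul_dep_sum n k n' k' :
  (0 < n)%N -> (0 < k)%N -> (0 < n')%N -> (0 < k')%N ->
  (n + k = n' + k')%N -> g n * g k = g n' * g k'.
Proof.
move=> n0 k0 n'0 k'0 e.
have := g_rec (isT : 0 < 1)%N n0 k0; rewrite -addnA e addnA g_rec //.
by move/addrI/(mulfI (monic_neq0 (monicXn _ _)))/addIr.
Qed.

(** The case [n = k = 1] of [g_rec] is a two-step recursion, so [g 1] and [g 2] determine [g] at all
    positive indices. *)
Lemma g_ind2 (h : nat -> {poly K}) :
  g 1 = h 1%N -> g 2 = h 2%N ->
  (forall m, (0 < m)%N -> h m.+2 = h m + 'X^m * (h 1%N ^+ 2 - 1)) ->
  forall n, (0 < n)%N -> g n = h n.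
Proof.
move=> g1 g2 h_rec.
suff gh n : g n.+1 = h n.+1 /\ g n.+2 = h n.+2 by case=> // n _; case: (gh n).
elim: n => [//|n [IH1 IH2]]; split=> //.
by rewrite h_rec // -IH1 -g1 expr2 -g_rec // !addn1.
Qed.

Lemma g_cases :
  (forall n, (0 < n)%N -> g n = 'X^n) \/ (forall n, (0 < n)%N -> g n = 1).
Proof.
have X0 : 'X != 0 :> {poly K} by rewrite polyX_eq0.
have g_neq0 n : g n != 0.
  by apply/eqP=> gn0; have /esym/eqP := g_at1 n; rewrite gn0 horner0 oner_eq0.
have e3 : g 3 = g 1 + 'X * (g 1 ^+ 2 - 1) by rewrite expr2 -['X]expr1 -g_rec.
have e4 : g 4 = g 2 + 'X^2 * (g 1 ^+ 2 - 1) by rewrite expr2 -g_rec.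
have e13 : g 1 * g 3 = g 2 ^+ 2 by rewrite expr2; apply: mul_dep_sum.
have e14 : g 1 * g 4 = g 2 * g 3 by apply: mul_dep_sum.
have /eqP : 'X * ((g 1 ^+ 2 - 1) * ('X * g 1 - g 2)) = 0.
  have -> : 'X * ((g 1 ^+ 2 - 1) * ('X * g 1 - g 2)) = g 1 * g 4 - g 2 * g 3.
    by rewrite e3 e4; ring.
  by rewrite e14 subrr.
rewrite !mulf_eq0 (negPf X0) /= => /orP[/eqP g11|].
  have g1 : g 1 = 1 by apply: sqr_eq1_at1 => //; apply/eqP; rewrite -subr_eq0 g11.
  (* Here [g 3 = g 1 = 1], so [e13] reads [g 2 ^+ 2 = 1]. *)
  have g2 : g 2 = 1.
    by apply: sqr_eq1_at1 => //; rewrite -e13 e3 g11 g1 mulr0 addr0 mulr1.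
  right; apply: (g_ind2 (h := fun=> 1)) => // m _.
  by rewrite expr1n subrr mulr0 addr0.
rewrite subr_eq0 => /eqP g2.
have g3 : g 3 = 'X^2 * g 1.
  by apply: (mulfI (g_neq0 1%N)); rewrite e13 -g2; ring.
(* The product is the difference of the two expressions [e3] and [g3] for [g 3]. *)
have /eqP : (g 1 - 'X) * ('X * g 1 + 1) = 0.
  have -> : (g 1 - 'X) * ('X * g 1 + 1) =
            g 1 + 'X * (g 1 ^+ 2 - 1) - 'X^2 * g 1 by ring.
  by rewrite -e3 g3 subrr.
(* The factor ['X * g 1 + 1] takes the value 1 at 0, so it cannot vanish. *)
rewrite mulf_eq0 => /orP[|/eqP/(congr1 (horner^~ 0))]; last first.
  by rewrite !hornerE => /eqP; rewrite oner_eq0.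
rewrite subr_eq0 => /eqP g1; left.
apply: (g_ind2 (h := fun n => 'X^n)) => [||m _]; first by rewrite g1.
  by rewrite -g2 g1.
by rewrite -addn2 exprD; ring.
Qed.

End MultiplicativeForm.

Theorem theorem4 (K : fieldType) (f : nat -> {poly K})
  (hf : forall m n k : nat, (0 < m)%N -> (0 < n)%N -> (0 < k)%N ->
    f (m + n + k)%N =
      f m + 'X^m * f n + 'X^m * f k + 'X^m * ('X - 1) * f n * f k) :
  (forall n : nat, (0 < n)%N -> f n = qint K n) \/
  (forall n : nat, (0 < n)%N -> f n = 0).
Proof.
have X1 : 'X - 1 != 0 :> {poly K} by rewrite -polyC1 polyXsubC_eq0.
pose g n := 1 + ('X - 1) * f n.
have g_at1 n : (g n).[1] = 1 by rewrite !hornerE subrr mul0r addr0.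
have g_rec m n k : (0 < m)%N -> (0 < n)%N -> (0 < k)%N ->
    g (m + n + k)%N = g m + 'X^m * (g n * g k - 1).
  by move=> m0 n0 k0; rewrite /g hf //; ring.
(* Cancelling ['X - 1] recovers [f]: [g n = 'X^n] gives the geometric sum, [g n = 1] gives 0. *)
case: (g_cases g_at1 g_rec) => gE; [left | right] => n n0; apply: (mulfI X1).
  by rewrite /qint -subrX1 -gE // /g; ring.
by apply: (addrI 1); rewrite -/(g n) gE // mulr0 addr0.
Qed.
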